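(* If $R$ is a left artinian ring, then the left big finitistic dimension $\ell\,\mathrm{Fin.dim}\,R$ equals $$\sup\{\operatorname{p\,dim} M \mid M \text{ a countably generated left } R\text{-module with } \operatorname{p\,dim} M<\infty\}.$$
   Context: $\operatorname{p\,dim}$ denotes projective dimension. The left big finitistic dimension $\ell\,\mathrm{Fin.dim}\,R$ is the supremum of the projective dimensions of all left $R$-modules of finite projective dimension (with no finiteness condition on generation). *)

(* Defs.v *)
From mathcomp Require Import all_boot all_order all_algebra.
From mathcomp Require Import boolp classical_sets functions cardinality.
From mathcomp Require Import constructive_ereal.

Set Implicit Arguments.
Unset Strict Implicit.
Unset Printing Implicit Defensive.

Import Order.TTheory GRing.Theory Num.Theory.

Local Open Scope classical_set_scope.
Local Open Scope ring_scope.

(* Submodules are boolean predicates closed under [GRing.submod_closed].  Since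
   [boolp] makes every proposition decidable, these are all the submodules;
   likewise every type carries the choice structure required by [lmodType]. *)

(* The scaling of [R^o] is multiplication on the left, so the submodules of
   [R^o] are the left ideals of [R]. *)
Definition left_artinian (R : pzRingType) : Prop :=
  forall I : nat -> {pred R^o},
    (forall n, GRing.submod_closed (I n)) ->
    (forall n, {subset I n.+1 <= I n}) ->
    exists n, forall m, (n <= m)%N -> I m =i I n.

Definition generates (R : pzRingType) (M : lmodType R) (G : set M) : Prop :=
  forall U : {pred M}, GRing.submod_closed U ->
    (forall x, G x -> x \in U) -> forall x, x \in U.

Definition countably_generated (R : pzRingType) (M : lmodType R) : Prop :=
  exists2 G : set M, countable G & generates G.

Definition projective (R : pzRingType) (P : lmodType R) : Prop :=
  forall (N M : lmodType R) (g : {linear N -> M}) (f : {linear P -> M}),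
    (forall y, exists x, g x = y) ->
    exists h : {linear P -> N}, forall x, g (h x) = f x.

Record projective_resolution (R : pzRingType) (M : lmodType R) := ProjRes {
  pr_obj : nat -> lmodType R;
  pr_diff : forall i, {linear pr_obj i.+1 -> pr_obj i};
  pr_aug : {linear pr_obj 0%N -> M};
  pr_projective : forall i, projective (pr_obj i);
  pr_aug_surj : forall y, exists x, pr_aug x = y;
  pr_exact0 : forall x, pr_aug x = 0 <-> exists y, pr_diff 0%N y = x;
  pr_exactS : forall i x,
    pr_diff i x = 0 <-> exists y, pr_diff i.+1 y = x }.

Definition has_proj_res_of_length (R : pzRingType) (M : lmodType R) (n : nat) :
    Prop :=
  exists C : projective_resolution M,
    forall i, (n < i)%N -> forall x : pr_obj C i, x = 0.

(* Dimensions are elements of [\bar int]; the values that occur are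
   [0, 1, 2, ..., +oo].  The first argument of [infimum] is its value at the
   empty set.  The zero module has dimension 0. *)
Definition pdim (R : pzRingType) (M : lmodType R) : \bar int :=
  infimum +oo%E [set (n%:Z)%:E | n in has_proj_res_of_length M].

(* The first argument of [supremum] is its value at the empty set, which does
   not arise below: the zero module has finite projective dimension. *)
Definition left_FinDim (R : pzRingType) : \bar int :=
  supremum 0%E
    [set d | exists M : lmodType R, (pdim M < +oo)%E /\ d = pdim M].

(* Main.v *)
(* Let [M] have projective dimension exactly [n + 1] and let [C] be a free resolution of [M]
   with differentials [d_i : C_(i+1) -> C_i].  A module has projective dimension at most [i]
   iff [d_i s d_i = d_i] for some linear [s : C_i -> C_(i+1)].  So there is such an [s] for
   [d_(n+1)], and [q = 1 - d_(n+1) s] is an idempotent with the same kernel as [d_n].  If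
   [d_n x] in [J C_n] always implied [q x] in [J C_(n+1)], where [J] is the Jacobson radical,
   then semisimplicity of [R/J] and nilpotency of [J] would produce an [s] for [d_n]; hence
   some [x] violates this implication.  Left ideals being countably generated, one can close
   the support of [x] to countable subsets of the bases such that the free submodules they
   span form an exact subcomplex stable under [s].  It resolves a countably generated
   submodule [N] of [M] of projective dimension at most [n + 1], and [x] prevents the
   dimension from being at most [n]: from [d_n t d_n = d_n] follows
   [q x = q (t (d_n x))], which lies in [J C_(n+1)]. *)
Require Import Defs.
From HB Require Import structures.
From mathcomp Require Import all_boot all_order all_algebra.
From mathcomp Require Import boolp classical_sets functions cardinality fsbigop.
From mathcomp Require Import constructive_ereal.

Set Implicit Arguments.
Unset Strict Implicit.
Unset Printing Implicit Defensive.

Import Order.TTheory GRing.Theory Num.Theory.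

Local Open Scope classical_set_scope.
Local Open Scope ring_scope.

Lemma countable_setU (T : Type) (A B : set T) :
  countable A -> countable B -> countable (A `|` B).
Proof.
move=> cA cB; rewrite -bigcup2E; apply: bigcup_countable => [|[|[|i]] _] //=.
Qed.

Lemma countable_image (T U : Type) (f : T -> U) (A : set T) :
  countable A -> countable (f @` A).
Proof. by move=> cA; apply: sub_countable cA; apply: card_image_le. Qed.

(** * Submodules and the radical of a left artinian ring *)

Section Submodules.
Variables (R : pzRingType) (M : lmodType R).
Implicit Types (U V W : set M) (a : R) (x y : M).

Definition submodule U :=
  U 0 /\ forall a x y, U x -> U y -> U (a *: x + y).

Lemma submodule0 U : submodule U -> U 0. Proof. by case. Qed.

Lemma submoduleD U x y : submodule U -> U x -> U y -> U (x + y).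
Proof. by move=> [_ h] /(h 1) hx /hx; rewrite scale1r. Qed.

Lemma submoduleZ U a x : submodule U -> U x -> U (a *: x).
Proof. by move=> [U0 h] Ux; rewrite -[_ *: _]addr0; apply: h. Qed.

Lemma submoduleN U x : submodule U -> U x -> U (- x).
Proof. by rewrite -scaleN1r; apply: submoduleZ. Qed.

Lemma submoduleB U x y : submodule U -> U x -> U y -> U (x - y).
Proof. by move=> sU Ux Uy; apply: submoduleD => //; apply: submoduleN. Qed.

Lemma submodule_closed U : submodule U -> GRing.submod_closed (mem U).
Proof.
move=> [U0 UD]; split; first exact/mem_set.
by move=> a x y /set_mem Ux /set_mem Uy; apply/mem_set/UD.
Qed.

Lemma submoduleI U V : submodule U -> submodule V -> submodule (U `&` V).
Proof.
move=> sU sV; split; first by split; apply: submodule0.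
by move=> a x y [Ux Vx] [Uy Vy]; split; apply: submoduleD => //; apply: submoduleZ.
Qed.

Lemma submoduleT : submodule [set: M].
Proof. by []. Qed.

Definition span (G : set M) : set M :=
  [set x | forall U, submodule U -> G `<=` U -> U x].

Lemma span_sub G : G `<=` span G.
Proof. by move=> x Gx U _; apply. Qed.

Lemma span_submodule G : submodule (span G).
Proof.
split=> [U sU _|a x y Gx Gy U sU GU]; first exact: submodule0.
by apply: submoduleD (submoduleZ _ sU _) _ => //; [apply: Gx | apply: Gy].
Qed.

Lemma span_min G U : submodule U -> G `<=` U -> span G `<=` U.
Proof. by move=> sU GU x; apply. Qed.

Lemma submodule_sum U V : submodule U -> submodule V ->
  submodule [set z | exists x y, [/\ U x, V y & z = x + y]].
Proof.
move=> sU sV; split.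
  by exists 0, 0; rewrite addr0; split => //; apply: submodule0.
move=> a _ _ [x1 [y1 [Ux1 Vy1 ->]]] [x2 [y2 [Ux2 Vy2 ->]]].
exists (a *: x1 + x2), (a *: y1 + y2); split.
- by apply: submoduleD => //; apply: submoduleZ.
- by apply: submoduleD => //; apply: submoduleZ.
- by rewrite scalerDr addrACA.
Qed.

Lemma submodule_cyclic x : submodule [set z | exists r : R, z = r *: x].
Proof.
split; first by exists 0; rewrite scale0r.
by move=> a _ _ [r ->] [s ->]; exists (a * r + s); rewrite scalerDl scalerA.
Qed.

(** [P] is a condition on single elements, so it passes to unions of chains. It serves for maximal
    left ideals, with [x <> 1], and for relative complements, with [U x -> W0 x]. *)
Lemma submodule_Zorn (W0 : set M) (P : M -> Prop) :
  submodule W0 -> (forall x, W0 x -> P x) ->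
  exists W, [/\ submodule W, W0 `<=` W, W `<=` P &
    forall W', submodule W' -> W `<=` W' -> W' `<=` P -> W' `<=` W].
Proof.
move=> sW0 W0P.
(* [A = set0] is allowed because the empty chain has empty union. *)
pose Q A := A `<=` P /\ (A = set0 \/ (submodule A /\ W0 `<=` A)).
have [|A [[AP A_or] Amax]] := @Zorn_bigcup M Q.
  move=> F FQ Ftot; split; first by move=> x [X FX Xx]; apply: (FQ X FX).1.
  have [allempty|] := pselect (forall X, F X -> X = set0).
    by left; rewrite -subset0 => x [X /allempty ->].
  move/existsNP=> [X /not_implyP[FX XN]]; right.
  have [_ [//|[sX W0X]]] := FQ _ FX.
  split; last by move=> x W0x; exists X => //; apply: W0X.
  split; first by exists X => //; apply: submodule0.
  move=> a x y [Y FY Yx] [Z FZ Zy].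
  have sF V v : F V -> V v -> submodule V.
    by move=> /FQ[_ [->//|[]]].
  have [YZ|ZY] := Ftot _ _ FY FZ.
    by exists Z => //; apply: (sF _ y FZ Zy).2 => //; apply: YZ.
  by exists Y => //; apply: (sF _ x FY Yx).2 => //; apply: ZY.
have A_or' : submodule A /\ W0 `<=` A.
  case: A_or => // A0; exfalso; apply: (Amax W0).
    rewrite A0; split; first exact: sub0set.
    by move/(_ 0); apply; apply: submodule0.
  by split; [exact: W0P | right; split].
case: A_or' => sA W0A; exists A; split => //.
move=> W' sW' AW' W'P; apply: contrapT => nsub; apply: (Amax W') => //.
by split; [exact: W'P | right; split => //; apply: subset_trans AW'].
Qed.

End Submodules.

(** * Semisimplicity modulo the radical and nilpotency of the radical *)

Section ArtinianRadical.
Variable R : pzRingType.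
Implicit Types (I J K L m : set R^o) (a b e r s : R).

Definition maximal_left_ideal m :=
  [/\ submodule m, ~ m 1 &
    forall I, submodule I -> m `<=` I -> ~ I 1 -> I `<=` m].

Definition jacobson : set R^o :=
  [set a | forall m, maximal_left_ideal m -> m a].

Lemma left_idealD I x y : submodule I -> I x -> I y -> I (x + y).
Proof. exact: (@submoduleD R R^o). Qed.

Lemma left_idealB I x y : submodule I -> I x -> I y -> I (x - y).
Proof. exact: (@submoduleB R R^o). Qed.

Lemma left_idealZ I r x : submodule I -> I x -> I (r * x).
Proof. exact: (@submoduleZ R R^o). Qed.

Lemma maximal_left_ideal_exists L : submodule L -> ~ L 1 ->
  exists2 m, maximal_left_ideal m & L `<=` m.
Proof.
move=> sL L1.
have [x Lx x1|m [sm Lm mN mmax]] := @submodule_Zorn R R^o L (fun x => x <> 1) sL.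
  by apply: L1; rewrite -x1.
exists m => //; split => //; first by move/mN.
by move=> I sI mI I1; apply: mmax => // x Ix x1; apply: I1; rewrite -x1.
Qed.

(** Otherwise [m + R a] would be a proper left ideal strictly above [m]. *)
Lemma maximal_left_idealP m a : maximal_left_ideal m -> ~ m a ->
  exists r, m (1 - r * a).
Proof.
move=> [sm m1 mmax] ma.
pose I := [set z : R^o | exists x y, [/\ m x, exists r, y = r * a & z = x + y]].
have sI : submodule I := submodule_sum sm (submodule_cyclic (a : R^o)).
have [[x [_ [mx [r ->] ->]]]|I1] := pselect (I 1).
  by exists r; rewrite addrK.
case: ma; apply: (mmax I) => //.
  by move=> x mx; exists x, 0; split; rewrite ?addr0 //; exists 0; rewrite mul0r.
exists 0, a; split; rewrite ?add0r //; first exact: submodule0.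
by exists 1; rewrite mul1r.
Qed.

Lemma jacobson_submodule : submodule jacobson.
Proof.
split=> [m [sm _ _]|a x y Jx Jy m mm]; first exact: submodule0.
by case: (mm) => sm _ _; apply: sm.2; [apply: Jx | apply: Jy].
Qed.

Lemma submodule_mulr_preim L b : submodule L -> submodule [set r : R^o | L (r * b)].
Proof.
move=> sL; split=> /=; first by rewrite mul0r; apply: submodule0.
by move=> a x y Lx Ly; rewrite mulrDl -mulrA; apply: sL.2.
Qed.

(** The radical is defined through left ideals, so stability on the right needs an argument: for [r]
    outside a maximal [m], the [x] with [x * r] in [m] again form a maximal left ideal. *)
Lemma jacobson_mulr a r : jacobson a -> jacobson (a * r).
Proof.
move=> Ja m mm; have [sm m1 mmax] := mm.
have [mr|mr] := pselect (m r); first exact: (left_idealZ a sm).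
pose m' : set R^o := [set x | m (x * r)].
have sm' : submodule m' by apply: submodule_mulr_preim.
apply: (Ja m'); split => //; first by rewrite /m' /= mul1r.
move=> I sI m'I I1 x Ix; apply: contrapT => nm'.
have [s ms] := maximal_left_idealP mm nm'.
(* [1 - r s x] lies in [m'], because [(1 - r s x) r = r (1 - s x r)] lies in [m]. *)
apply: I1; rewrite -[1](subrK (r * s * x)); apply: left_idealD => //.
  by apply: m'I; rewrite /m' /= mulrBl mul1r -!mulrA -{1}[r]mulr1 -mulrBr; apply: (left_idealZ r sm).
exact: (left_idealZ (r * s) sI).
Qed.

(** If [R (1 - a)] were proper, a maximal left ideal above it would contain both [1 - a] and [a]. *)
Lemma jacobson_left_inverse a : jacobson a -> exists b, b * (1 - a) = 1.
Proof.
move=> Ja; pose L := [set z : R^o | exists r : R, z = r * (1 - a)].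
have sL : submodule L := submodule_cyclic ((1 - a) : R^o).
have [[b bE]|L1] := pselect (L 1); first by exists b.
have [m mm Lm] := maximal_left_ideal_exists sL L1.
case: (mm) => sm m1 _; case: m1; rewrite -[1](subrK a); apply: left_idealD => //; last exact: Ja.
by apply: Lm; exists 1; rewrite mul1r.
Qed.

(* [e] is zero or generates a simple submodule modulo [I]. *)
Definition simple_mod I e := forall r, I (r * e) \/ exists s, I (s * (r * e) - e).

(** Semisimplicity of [R/I]: its simple submodules generate it. Quantifying over [L] replaces
    quotients and finite sums. *)
Definition unit_sum_of_simples I := forall L, submodule L -> I `<=` L ->
  (forall e, simple_mod I e -> L e) -> L 1.

(** If [I] is not inside [m], write [1 = b + a] with [a] in [I] and [b] in [m]. Right multiplication
    by [b] maps [I] into the intersection and carries elements simple modulo [I] to elements simple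
    modulo the intersection, while [a] generates the image of [I], a copy of the simple module
    [R/m]. *)
Lemma unit_sum_of_simplesI I m : submodule I -> maximal_left_ideal m ->
  unit_sum_of_simples I -> unit_sum_of_simples (I `&` m).
Proof.
move=> sI mm hI; have [sm _ _] := mm.
have [Im|] := pselect (I `<=` m); first by rewrite setIidl.
move/existsNP=> [c /not_implyP[Ic mc]].
have [t] := maximal_left_idealP mm mc.
set a := t * c; set b := 1 - a => mb.
have Ia : I a by apply: (left_idealZ t sI).
have bE x : x * b = x - x * a by rewrite mulrBr mulr1.
have Ib x : I x -> (I `&` m) (x * b).
  move=> Ix; split; last exact: (left_idealZ x sm).
  by rewrite bE; apply: left_idealB => //; apply: (left_idealZ x sI).
move=> L sL IL Lsimple; rewrite -[1](subrK a); apply: left_idealD => //.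
  rewrite -[X in L X]mul1r; apply: (hI [set r : R^o | L (r * b)]).
  - exact: submodule_mulr_preim.
  - by move=> x Ix; apply/IL/Ib.
  - move=> e se; apply: Lsimple => r; have [Ire|[s Is]] := se r.
      by left; rewrite mulrA; apply: Ib.
    by right; exists s; rewrite !mulrA -mulrBl -mulrA; apply: Ib.
apply: Lsimple => r; have [mra|mra] := pselect (m (r * a)).
  by left; split => //; apply: (left_idealZ r sI).
right; have [s ms] := maximal_left_idealP mm mra.
exists (a * s); split.
  by apply: left_idealB => //; apply: (left_idealZ (a * s) sI); apply: (left_idealZ r sI).
rewrite -opprB; apply: (@submoduleN R R^o) => //.
by rewrite -{1}[a]mulr1 -mulrA -mulrBr; apply: (left_idealZ a sm).
Qed.

Inductive maximal_intersection : set R^o -> Prop :=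
| MaxIntT : maximal_intersection setT
| MaxIntI I m : maximal_intersection I -> maximal_left_ideal m ->
    maximal_intersection (I `&` m).

Lemma maximal_intersection_submodule I : maximal_intersection I -> submodule I.
Proof. by elim=> // {}I m _ sI [sm _ _]; apply: submoduleI. Qed.

Lemma maximal_intersection_unit I :
  maximal_intersection I -> unit_sum_of_simples I.
Proof.
elim=> [L sL TL _|{}I m hI]; first exact: TL.
by move=> uI mm; apply: unit_sum_of_simplesI => //; apply: maximal_intersection_submodule.
Qed.

Fixpoint jpow k : set R^o :=
  if k is k.+1 then span [set z : R^o | exists a b, [/\ jpow k a, jacobson b & z = a * b]]
  else setT.

Lemma jpow_submodule k : submodule (jpow k).
Proof. by case: k => [|k] //; apply: span_submodule. Qed.

Lemma jpow_mul k a b : jpow k a -> jacobson b -> jpow k.+1 (a * b).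
Proof. by move=> ha hb; apply: span_sub; exists a, b. Qed.

Lemma jpow_mulr k a r : jpow k a -> jpow k (a * r).
Proof.
case: k => // k; apply: span_min (submodule_mulr_preim r (jpow_submodule k.+1)) _ _.
move=> _ [x [y [hx hy ->]]] /=; rewrite -mulrA; apply: jpow_mul => //.
exact: jacobson_mulr.
Qed.

Lemma jpowS k : jpow k.+1 `<=` jpow k.
Proof.
by apply: (span_min (jpow_submodule k)) => _ [x [y [hx hy ->]]]; apply: jpow_mulr.
Qed.

Hypothesis artR : left_artinian R.

(** Without a minimal member, dependent choice yields a strictly decreasing sequence of left
    ideals. *)
Lemma artinian_min (P : set (set R^o)) I0 : (forall I, P I -> submodule I) -> P I0 ->
  exists2 I, P I & forall I', P I' -> I' `<=` I -> I `<=` I'.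
Proof.
move=> Psub PI0; apply: contrapT => nomin.
have step (I : {I | P I}) : {I' : {I | P I} | sval I' `<=` sval I /\ ~ (sval I `<=` sval I')}.
  apply: cid; apply: contrapT => h; apply: nomin; exists (sval I); first exact: svalP I.
  move=> I' PI' I'I; apply: contrapT => nI; apply: h.
  by exists (exist _ I' PI').
have [f [_ fdec]] := dependent_choice step (exist _ I0 PI0).
have [||n hn] := artR (I := fun n => mem (sval (f n))).
- by move=> n; apply/submodule_closed/Psub/(svalP (f n)).
- by move=> n x /set_mem h; apply/mem_set/(fdec n).1.
apply: (fdec n).2 => x fx; apply/set_mem; rewrite -[_ \in _]/(x \in mem (sval (f n.+1))).
by rewrite (hn n.+1 (leqnSn n)); apply/mem_set.
Qed.

(** A minimal finite intersection of maximal left ideals lies in every maximal left ideal, so it is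
    the radical. *)
Lemma jacobson_unit_sum : unit_sum_of_simples jacobson.
Proof.
have [J hJ Jmin] := artinian_min maximal_intersection_submodule MaxIntT.
suff <- : J = jacobson by exact: maximal_intersection_unit.
apply/seteqP; split=> [x Jx m mm|x].
  by have [_] := Jmin _ (MaxIntI hJ mm) (@subIsetl _ _ _) _ Jx.
by elim: hJ => {J Jmin} // J m _ hJ mm jx; split; [apply: hJ | apply: jx].
Qed.

(** Let [J^k] be the least power, so [J^k = J^(k+1)]. If it is nonzero, take [L] minimal among the
    left ideals not annihilated by [J^k], and [x] in [L] with [J^k x] nonzero. Then [L = J x], so
    [x = b x] with [b] in [J], and left invertibility of [1 - b] gives [x = 0]. *)
Lemma jacobson_nilpotent : exists k, jpow k `<=` [set 0].
Proof.
have [||_ [k _ <-] kmin] := @artinian_min (range jpow) (jpow 0).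
- by move=> _ [k _ <-]; apply: jpow_submodule.
- by exists 0%N.
exists k => a0 ka0 /=; apply: contrapT => a0N.
have kS : jpow k `<=` jpow k.+1 by apply: kmin; [exists k.+1 | apply: jpowS].
pose P L := submodule L /\ exists a x, [/\ jpow k a, L x & a * x <> 0].
have [||L [sL [a [x [ka Lx ax]]]] Lmin] := @artinian_min P setT.
- by move=> L [].
- by split; [apply: submoduleT | exists a0, 1; rewrite mulr1].
pose L' := [set z : R^o | exists2 b, jacobson b & z = b * x].
have sL' : submodule L'.
  split; first by exists 0; rewrite ?mul0r //; apply: submodule0 jacobson_submodule.
  move=> c _ _ [b1 hb1 ->] [b2 hb2 ->]; exists (c * b1 + b2).
    exact: jacobson_submodule.2.
  by rewrite mulrDl -mulrA.
have [||b Jb xE] := Lmin L' _ _ x Lx.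
(* Were [J x] annihilated by [J^k], then [J^(k+1) x = J^k x] would vanish. *)
- split => //; apply: contrapT => h; apply: ax.
  have sA : submodule [set c : R^o | c * x = 0].
    by split=> /= [|c y z]; rewrite ?mul0r // mulrDl -mulrA => -> ->; rewrite mulr0 addr0.
  apply: (span_min sA _ (kS _ ka)) => _ [c [b [kc Jb ->]]] /=.
  apply: contrapT => cbx; apply: h; exists c, (b * x).
  by split; [| exists b | rewrite mulrA].
- by move=> _ [b Jb ->]; apply: (left_idealZ b sL).
apply: ax; have [c cE] := jacobson_left_inverse Jb.
by rewrite -[x]mul1r -cE -mulrA mulrBl mul1r -xE subrr !mulr0.
Qed.

(** The hypothesis amounts to [K] being contained in [L + J K]. Nilpotency of [J] takes the place of
    finite generation. *)
Lemma nakayama (M : lmodType R) (K L : set M) : submodule L ->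
  (forall U, submodule U -> L `<=` U ->
     (forall (j : R) x, jacobson j -> K x -> U (j *: x)) -> K `<=` U) ->
  K `<=` L.
Proof.
move=> sL hL; have [k k0] := jacobson_nilpotent.
suff H n W : submodule W -> L `<=` W -> (forall (a : R) x, jpow n a -> K x -> W (a *: x)) -> K `<=` W.
  by apply: (H k) => // a x /k0 -> _; rewrite scale0r; apply: submodule0.
elim: n W => [|n IHn] W sW LW nW.
  by move=> x Kx; rewrite -[x]scale1r; apply: nW.
apply: IHn => // a x na Kx.
(* Here [J^(n+1) K] is inside [W], so the submodule of all [x] with [J^n x] inside [W] contains
   [J K]; it also contains [L], hence [K]. *)
apply: (hL [set x | forall a : R, jpow n a -> W (a *: x)]) => //.
- split=> [b _|b y z hy hz c nc] /=; first by rewrite scaler0; apply: submodule0.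
  rewrite scalerDr scalerA; apply: submoduleD => //; last exact: hz.
  by apply: hy; apply: jpow_mulr.
- by move=> y Ly b _; apply: submoduleZ => //; apply: LW.
- by move=> j y Jj Ky b nb; rewrite scalerA; apply: nW => //; apply: jpow_mul.
Qed.

(** [V/W0] is a module over the semisimple ring [R/J], so [U/W0] has a complement in it. [W] is
    taken maximal among the submodules of [V] above [W0] that meet [U] inside [W0]. *)
Lemma complement_mod_jacobson (M : lmodType R) (V W0 U : set M) :
  submodule V -> submodule W0 -> submodule U -> W0 `<=` U -> U `<=` V ->
  (forall (j : R) x, jacobson j -> V x -> W0 (j *: x)) ->
  exists W, [/\ submodule W, W0 `<=` W, W `<=` V, W `&` U `<=` W0 &
    forall x, V x -> exists w u, [/\ W w, U u & x = w + u]].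
Proof.
move=> sV sW0 sU W0U UV JW0.
pose P x := V x /\ (U x -> W0 x).
have [x W0x|W [sW W0W WP Wmax]] := @submodule_Zorn R M W0 P sW0.
  by split => //; apply/UV/W0U.
have WV : W `<=` V by move=> x /WP[].
exists W; split => //; first by move=> x [/WP[_ h] /h].
move=> v Vv; apply: contrapT => vN.
pose S := [set z | exists w u, [/\ W w, U u & z = w + u]].
have sS : submodule S by apply: submodule_sum.
have WS : W `<=` S by move=> w Ww; exists w, 0; rewrite addr0; split => //; apply: submodule0.
have US : U `<=` S by move=> u Uu; exists 0, u; rewrite add0r; split => //; apply: submodule0.
(* The elements simple modulo [J] generate [R/J]; if all of them sent [v] into [S], then [v] itself
   would be in [S]. *)
have [e /not_implyP[se Sev]] : exists e, ~ (simple_mod jacobson e -> S (e *: v)).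
  apply/existsNP => h; apply: vN; rewrite -/(S v) -[v]scale1r.
  change ([set r : R | S (r *: v)] 1); apply: jacobson_unit_sum => //.
  - split=> /= [|a x y hx hy]; first by rewrite scale0r; apply: submodule0.
    by rewrite scalerDl -scalerA; apply: sS.2.
  - by move=> j Jj; apply/WS/W0W/JW0.
set y := e *: v in Sev; have Vy : V y by apply: submoduleZ.
apply/Sev/WS.
(* [W + R y] contradicts maximality. If [w + r y] is in [U], either [r y] is already in [W0], or a
   multiple of [r y] equals [y] modulo [W0], which would put [y] in [S]. *)
pose W1 := [set z | exists w x, [/\ W w, exists r : R, x = r *: y & z = w + x]].
apply: (Wmax W1).
- exact: submodule_sum (submodule_cyclic y).
- by move=> w Ww; exists w, 0; rewrite addr0; split => //; exists 0; rewrite scale0r.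
- move=> _ [w [_ [Ww [r ->] ->]]]; split.
    by apply: submoduleD => //; [apply: WV | apply: submoduleZ].
  move=> Uwy; have [Jre|[s Js]] := se r.
    have W0y : W0 (r *: y) by rewrite scalerA; apply: JW0.
    by apply: (WP _ _).2 => //; apply: submoduleD => //; apply: W0W.
  case: Sev; rewrite -[y](subKr (s *: (r *: y))); apply: submoduleB => //.
    rewrite -[r *: y](addKr w) scalerDr scalerN; apply: submoduleD => //.
      by apply: submoduleN => //; apply: submoduleZ => //; apply: WS.
    by apply: submoduleZ => //; apply: US.
  by apply/WS/W0W; rewrite /y !scalerA -mulrA -scalerBl; apply: JW0.
- exists 0, y; rewrite add0r; split => //; first exact: submodule0.
  by exists 1; rewrite scale1r.
Qed.

(** Take [W] minimal between [J K] and [K] such that [W] and countably many elements generate [K].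
    An [x] in [W] outside [J K] could be added to these elements and [W] cut down by a complement of
    [J K + R x]. So [W = J K], and Nakayama discards it. *)
Lemma artinian_countably_generated (K : set R^o) : submodule K ->
  exists G, [/\ countable G, G `<=` K & K `<=` span G].
Proof.
move=> sK; pose JK := span [set z : R^o | exists j x, [/\ jacobson j, K x & z = j * x]].
have sJK : submodule JK by apply: span_submodule.
have JKK : JK `<=` K.
  by apply: (span_min sK) => _ [j [x [_ Kx ->]]]; apply: (left_idealZ j sK).
have JKJ (j : R) (x : R^o) : jacobson j -> K x -> JK (j *: x).
  by move=> Jj Kx; apply: span_sub; exists j, x.
pose P W := [/\ submodule W, JK `<=` W, W `<=` K &
  exists G, [/\ countable G, G `<=` K & K `<=` span (G `|` W)]].
have [||W [sW JKW WK [G [cG GK KG]]] Wmin] := @artinian_min P K.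
- by move=> W [].
- split=> //; exists set0; split => //; rewrite set0U; exact: span_sub.
have [WJK|/existsNP[x /not_implyP[Wx xN]]] := pselect (W `<=` JK).
  exists G; split => //; apply: nakayama => [|U sU GU JU]; first exact: span_submodule.
  apply: subset_trans KG _; apply: span_min => //; rewrite subUset; split.
    by apply: subset_trans GU; apply: span_sub.
  apply: subset_trans WJK _; apply: span_min => // _ [j [y [Jj Ky ->]]].
  exact: JU.
pose U := [set z : R^o | exists w y : R^o, [/\ JK w, exists r : R, y = r *: x & z = w + y]].
have sU : submodule U by apply: submodule_sum => //; apply: submodule_cyclic.
have Ux : U x.
  exists 0, x; rewrite add0r; split => //; first exact: submodule0.
  by exists 1; rewrite scale1r.
have [|||W' [sW' JKW' W'K W'U KE]] := complement_mod_jacobson sK sJK sU.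
- by move=> w Ww; exists w, 0; rewrite addr0; split => //; exists 0; rewrite scale0r.
- move=> _ [w [_ [/JKK Kw [r ->] ->]]]; apply: submoduleD => //.
  by apply: submoduleZ => //; apply: WK.
- exact: JKJ.
case: xN; apply: W'U; split => //.
suff : W `<=` W `&` W' by case/(_ x Wx).
apply: (Wmin (W `&` W') _ (@subIsetl _ _ _)).
split; first exact: submoduleI.
- by move=> w Ww; split; [apply: JKW | apply: JKW'].
- by move=> w [/WK].
exists (G `|` [set x]); split.
- exact/countable_setU.
- by move=> w [/GK //|->]; apply: WK.
apply: subset_trans KG _; apply: span_min; first exact: span_submodule.
rewrite subUset; split=> w; first by move=> Gw; apply: span_sub; left; left.
move=> Ww; set G' := _ `|` _.
have sG' : submodule (span G') by apply: span_submodule.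
have [w' [_ [W'w' [w0 [_ [JKw0 [r ->] ->]]] wE]]] := KE _ (WK _ Ww).
have G'x : span G' x by apply: span_sub; left; right.
have G'W z : (W `&` W') z -> span G' z by move=> h; apply: span_sub; right.
rewrite wE; apply: (left_idealD sG'); last apply: (left_idealD sG').
- apply: G'W; split => //.
  rewrite -[w'](addrK (w0 + r *: x)) -wE; apply: (left_idealB sW) => //.
  by apply: (left_idealD sW); [apply: JKW | apply: (left_idealZ r sW)].
- by apply: G'W; split; [apply: JKW | apply: JKW'].
- exact: (left_idealZ r sG').
Qed.

End ArtinianRadical.

(** * Projective dimension from a projective resolution *)

Section SubmoduleType.
Variables (R : pzRingType) (M : lmodType R) (U : set M) (sU : submodule U).

(* The phantom argument [sU] makes the closure proof available to the instances. *)
Definition submod_pred of submodule U : {pred M} := mem U.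
HB.instance Definition _ := GRing.isSubmodClosed.Build R M (submod_pred sU)
  (submodule_closed sU).
Definition submod : Type := {x : M | x \in submod_pred sU}.
HB.instance Definition _ := [isSub of submod for sval].
HB.instance Definition _ := [Choice of submod by <:].
HB.instance Definition _ := [SubChoice_isSubLmodule of submod by <:].

Definition submod_val : submod -> M := \val.
HB.instance Definition _ := GRing.Linear.on submod_val.

End SubmoduleType.

Section LinearMaps.
Variable R : pzRingType.
Implicit Types A B M P Q : lmodType R.

Lemma linear_of A B (f : A -> B) : (forall a x y, f (a *: x + y) = a *: f x + f y) ->
  exists g : {linear A -> B}, g =1 f.
Proof.
move=> flin; pose g := GRing.isLinear.Build R A B *:%R f flin.
by exists (HB.pack_for {linear A -> B} f g).
Qed.

Lemma submod_valP M (U : set M) (sU : submodule U) (x : submod sU) : U (submod_val x).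
Proof. exact/set_mem/(valP x). Qed.

Lemma submod_val_inj M (U : set M) (sU : submodule U) : injective (@submod_val R M U sU).
Proof. exact: val_inj. Qed.

Lemma submod_sub M (U : set M) (sU : submodule U) x : U x ->
  exists y : submod sU, submod_val y = x.
Proof. by move=> /mem_set Ux; exists (Sub x Ux); rewrite /submod_val SubK. Qed.

Lemma submod_corestrict A M (U : set M) (sU : submodule U) (f : {linear A -> M}) :
  (forall x, U (f x)) -> exists g : {linear A -> submod sU}, forall x, submod_val (g x) = f x.
Proof.
move=> Uf; have [g gE] := choice (fun x => submod_sub sU (Uf x)).
have [|h hg] := linear_of (f := g); last by exists h => x; rewrite hg.
by move=> a x y; apply: submod_val_inj; rewrite linearP /= !gE linearP.
Qed.

Lemma linear_factor A B M (g : {linear A -> M}) (f : {linear A -> B}) :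
  (forall y, exists x, g x = y) -> (forall x, g x = 0 -> f x = 0) ->
  exists h : {linear M -> B}, forall x, h (g x) = f x.
Proof.
move=> /choice[c cE] gf.
have E x y : g x = g y -> f x = f y.
  move=> gxy; apply/eqP; rewrite -subr_eq0 -linearB; apply/eqP/gf.
  by rewrite linearB gxy subrr.
have [|h hE] := linear_of (f := fun y => f (c y)).
  by move=> a x y; rewrite -linearP; apply: E; rewrite linearP !cE.
by exists h => x; rewrite hE; apply: E.
Qed.

Lemma image_submodule A M (f : {linear A -> M}) (U : set A) : submodule U -> submodule (f @` U).
Proof.
move=> sU; split; first by exists 0; rewrite ?linear0 //; apply: submodule0.
by move=> a _ _ [x Ux <-] [y Uy <-]; exists (a *: x + y); [apply: sU.2 | rewrite linearP].
Qed.

Lemma preimage_submodule A M (f : {linear A -> M}) (U : set M) :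
  submodule U -> submodule (f @^-1` U).
Proof.
move=> sU; split=> [|a x y]; rewrite /preimage /=; first by rewrite linear0; apply: submodule0.
by rewrite linearP; apply: sU.2.
Qed.

Lemma submodule_eq0 M : submodule [set 0 : M].
Proof. by split => // a _ _ -> ->; rewrite scaler0 addr0. Qed.

Definition kernel A M (f : {linear A -> M}) : lmodType R :=
  submod (preimage_submodule f (submodule_eq0 M)).

Lemma kernelP A M (f : {linear A -> M}) (x : kernel f) : f (submod_val x) = 0.
Proof. exact: submod_valP x. Qed.

(** [d] need not be surjective: both maps are corestricted to its range. *)
Lemma projective_lift P A B (d : {linear A -> B}) (f : {linear P -> B}) : projective P ->
  (forall x, exists y, d y = f x) -> exists h : {linear P -> A}, forall x, d (h x) = f x.
Proof.
move=> projP fd; have sD := image_submodule d (submoduleT A).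
have [|d' d'E] := submod_corestrict sD (f := d); first by move=> x; exists x.
have [|f' f'E] := submod_corestrict sD (f := f).
  by move=> x; have [y <-] := fd x; exists y.
have [|h hE] := projP _ _ d' f'.
  move=> y; have [x _ xE] := submod_valP y; exists x.
  by apply: submod_val_inj; rewrite d'E.
by exists h => x; rewrite -d'E hE f'E.
Qed.

Lemma projective_retract P Q (i : {linear Q -> P}) (r : {linear P -> Q}) :
  cancel i r -> projective P -> projective Q.
Proof.
move=> irK projP N M g f gsurj.
have [h hE] := projP N M g (f \o r : {linear P -> M}) gsurj.
by exists (h \o i : {linear Q -> N}) => x /=; rewrite hE /= irK.
Qed.

Lemma projective_zero M : (forall x : M, x = 0) -> projective M.
Proof.
move=> M0 A B g f _; exists (\0 : {linear M -> A}) => x.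
by rewrite (M0 x) !linear0.
Qed.

Lemma has_res0 M : projective M -> has_proj_res_of_length M 0.
Proof.
move=> projM; pose Z : lmodType R := submod (submodule_eq0 M).
have Z0 (x : Z) : x = 0 by apply: submod_val_inj; rewrite linear0; exact: submod_valP x.
pose obj n : lmodType R := if n is 0 then M else Z.
unshelve eexists (@ProjRes R M obj (fun i => \0) (idfun : {linear M -> M}) _ _ _ _).
- by case=> [|i] //=; apply: projective_zero.
- by move=> y; exists y.
- move=> x /=; split=> [->|[y <-]] //.
  by exists 0.
- by move=> i x; split=> _ //; exists 0; rewrite (Z0 x).
- by case=> // i _ x; apply: Z0.
Qed.

Lemma has_res_extend M P (g : {linear P -> M}) n : projective P ->
  (forall y, exists x, g x = y) -> has_proj_res_of_length (kernel g) n ->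
  has_proj_res_of_length M n.+1.
Proof.
move=> projP gsurj [C C0].
pose obj i : lmodType R := if i is i.+1 then pr_obj C i else P.
pose diff i : {linear obj i.+1 -> obj i} :=
  if i is i.+1 then pr_diff C i else
    (@submod_val R P _ _ : {linear kernel g -> P}) \o pr_aug C.
unshelve eexists (@ProjRes R M obj diff g _ gsurj _ _).
- by case=> //= i; apply: pr_projective.
- move=> x; split=> [gx|[y <-]] /=; last exact: kernelP.
  have [z <-] := submod_sub (preimage_submodule g (submodule_eq0 M)) gx.
  by have [y <-] := pr_aug_surj C z; exists y.
- case=> [|i] x /=; last exact: pr_exactS.
  rewrite -pr_exact0; split=> [h|->]; last by rewrite linear0.
  by apply: submod_val_inj; rewrite h linear0.
- by case=> // i; rewrite ltnS => ni x; apply: (C0 i).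
Qed.

Lemma has_res_monotone M m n : (m <= n)%N ->
  has_proj_res_of_length M m -> has_proj_res_of_length M n.
Proof. by move=> mn [C C0]; exists C => i ni; apply: C0; apply: leq_ltn_trans ni. Qed.

Lemma shift_aug M (C : projective_resolution M) :
  {a : {linear pr_obj C 1 -> kernel (pr_aug C)} | forall x, submod_val (a x) = pr_diff C 0 x}.
Proof.
by apply: cid; apply: submod_corestrict => x; apply/pr_exact0; exists x.
Qed.

(** Transparent, so that objects and differentials reduce to those of [C] one degree higher. *)
Definition shift_res M (C : projective_resolution M) : projective_resolution (kernel (pr_aug C)).
Proof.
move: (svalP (shift_aug C)); set a := sval _ => aE.
apply: (@ProjRes R _ (fun i => pr_obj C i.+1) (fun i => pr_diff C i.+1) a).
- by move=> i; apply: pr_projective.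
- move=> y; have /pr_exact0[x xE] := kernelP y.
  by exists x; apply: submod_val_inj; rewrite aE.
- move=> x; rewrite -pr_exactS -aE; split=> [->|h]; first by rewrite linear0.
  by apply: submod_val_inj; rewrite h linear0.
- by move=> i x; apply: pr_exactS.
Defined.

Lemma pr_diffK M (C : projective_resolution M) i x : pr_diff C i (pr_diff C i.+1 x) = 0.
Proof. by apply/pr_exactS; exists x. Qed.

Lemma pr_augK M (C : projective_resolution M) x : pr_aug C (pr_diff C 0 x) = 0.
Proof. by apply/pr_exact0; exists x. Qed.

(** By projectivity of [C_n], this means that the range of [d_n] is a direct summand of [C_n], that
    is, that the [n]-th syzygy is projective. *)
Definition splits_at M (C : projective_resolution M) n :=
  exists s : {linear pr_obj C n -> pr_obj C n.+1},
    forall x, pr_diff C n (s (pr_diff C n x)) = pr_diff C n x.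

Lemma splits_at_has_res M (C : projective_resolution M) n :
  splits_at C n -> has_proj_res_of_length M n.
Proof.
elim: n M C => [|n IHn] M C [s sE].
  apply: has_res0.
  (* [1 - d_0 s] vanishes on the kernel of the augmentation, hence induces a section of it, and [M]
     is a retract of [C_0]. *)
  have [||h hE] := @linear_factor _ _ _ (pr_aug C)
    (idfun \- (pr_diff C 0 \o s) : {linear pr_obj C 0%N -> pr_obj C 0%N}).
  - exact: pr_aug_surj.
  - by move=> _ /pr_exact0[y <-] /=; rewrite sE subrr.
  suff hK : cancel h (pr_aug C) by exact: (projective_retract hK (@pr_projective _ _ C 0%N)).
  move=> y; have [x <-] := pr_aug_surj C y; by rewrite hE /= linearB pr_augK subr0.
apply: (has_res_extend (@pr_projective _ _ C 0) (pr_aug_surj C)).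
by apply: (IHn _ (shift_res C)); exists s => x; apply: sE.
Qed.

(* Comparing [C] with a resolution [P] of length [n] through [f] and [g], a contracting
   homotopy [s] of [1 - g f] satisfies [d s d = d - g f d], and [f d = 0] in degree [n]. *)
Lemma has_res_splits_at M (C : projective_resolution M) n :
  has_proj_res_of_length M n -> splits_at C n.
Proof.
move=> [P P0].
(* The first two clauses are what lifting [f] and [g] to the next degree requires, so the
   augmentations occur only in the base case. *)
have H i : exists (f : {linear pr_obj C i -> pr_obj P i})
    (g : {linear pr_obj P i -> pr_obj C i})
    (s : {linear pr_obj C i -> pr_obj C i.+1}),
  [/\ forall x, exists y, pr_diff P i y = f (pr_diff C i x),
    forall x, exists y, pr_diff C i y = g (pr_diff P i x) &
    forall x, pr_diff C i (s (pr_diff C i x)) =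
      pr_diff C i x - g (f (pr_diff C i x))].
  elim: i => [|i [f [g [s [fd gd sd]]]]].
    have [|f fE] := projective_lift (d := pr_aug P) (f := pr_aug C) (@pr_projective _ _ C 0).
      by move=> x; apply: pr_aug_surj.
    have [|g gE] := projective_lift (d := pr_aug C) (f := pr_aug P) (@pr_projective _ _ P 0).
      by move=> x; apply: pr_aug_surj.
    have [|s sE] := projective_lift (d := pr_diff C 0)
        (f := idfun \- (g \o f) : {linear pr_obj C 0%N -> pr_obj C 0%N}) (@pr_projective _ _ C 0).
      by move=> x /=; apply/pr_exact0; rewrite linearB gE fE subrr.
    exists f, g, s; split=> x.
    - by apply/pr_exact0; rewrite fE pr_augK.
    - by apply/pr_exact0; rewrite gE pr_augK.
    - by rewrite sE.
  have [|f' fE] := projective_lift (d := pr_diff P i)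
      (f := f \o pr_diff C i : {linear pr_obj C i.+1 -> pr_obj P i}) (@pr_projective _ _ C i.+1).
    by move=> x; apply: fd.
  have [|g' gE] := projective_lift (d := pr_diff C i)
      (f := g \o pr_diff P i : {linear pr_obj P i.+1 -> pr_obj C i}) (@pr_projective _ _ P i.+1).
    by move=> x; apply: gd.
  have [|s' sE] := projective_lift (d := pr_diff C i.+1)
      (f := (idfun \- (g' \o f')) \- (s \o pr_diff C i) :
         {linear pr_obj C i.+1 -> pr_obj C i.+1}) (@pr_projective _ _ C i.+1).
    move=> x /=; apply/pr_exactS; rewrite !linearB gE /= fE /= sd.
    by rewrite subrr.
  exists f', g', s'; split=> x.
  - by apply/pr_exactS; rewrite fE /= pr_diffK linear0.
  - by apply/pr_exactS; rewrite gE /= pr_diffK linear0.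
  - by rewrite sE /= pr_diffK linear0 subr0.
have [f [g [s [fd _ sd]]]] := H n; exists s => x.
have [y yE] := fd x.
by rewrite sd -yE (P0 n.+1 (leqnn _) y) !linear0 addr0.
Qed.

End LinearMaps.

(** * Free modules *)

Section FreeModules.
Variable R : pzRingType.

Section Basis.
Variable X : choiceType.

Definition finitely_supported : set (X -> R^o) := [set f | finite_set [set x | f x != 0]].

Lemma finitely_supported_submodule : submodule finitely_supported.
Proof.
split=> [|a f g hf hg]; rewrite /finitely_supported /=.
  by rewrite (_ : [set _ | _] = set0) // -subset0 => x /=; rewrite eqxx.
apply: sub_finite_set (_ : finite_set ([set x | f x != 0] `|` [set x | g x != 0])).
  move=> x /=; apply: contra_neqP => /not_orP[/negP/negPn/eqP fx /negP/negPn/eqP gx].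
  by rewrite -[LHS]/(a *: f x + g x) fx gx scaler0 addr0.
by rewrite finite_setU.
Qed.

Definition free : lmodType R := submod finitely_supported_submodule.

Definition coef x (f : free) : R^o := submod_val f x.

Lemma coef_linear x : linear (coef x).
Proof. by move=> a f g; rewrite /coef linearP. Qed.

HB.instance Definition _ x := GRing.isLinear.Build R free R^o *:%R (coef x) (coef_linear x).

Lemma coef0 x : coef x 0 = 0.
Proof. exact: linear0. Qed.

Lemma coefD x f g : coef x (f + g) = coef x f + coef x g.
Proof. exact: linearD. Qed.

Lemma coefZ x (a : R) f : coef x (a *: f) = a * coef x f.
Proof. by rewrite -[a *: f]addr0 [LHS]coef_linear coef0 addr0. Qed.

Lemma free_ext (f g : free) : (forall x, coef x f = coef x g) -> f = g.
Proof. by move=> fg; apply/submod_val_inj/funext. Qed.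

Lemma delta_subproof x : exists f : free, forall y, submod_val f y = (x == y)%:R.
Proof.
have [|f fE] := @submod_sub _ _ _ finitely_supported_submodule (fun y => (x == y)%:R).
  apply: (@sub_finite_set _ _ [set x]) (finite_set1 x) => y /=.
  by case: (x =P y) => [->|_] //; rewrite eqxx.
by exists f => y; rewrite fE.
Qed.

Definition delta x : free := sval (cid (delta_subproof x)).

Lemma coef_delta x y : coef y (delta x) = (x == y)%:R.
Proof. exact: (svalP (cid (delta_subproof x))). Qed.

Lemma free_support (f : free) : exists2 s : seq X, uniq s &
  forall x, x \notin s -> coef x f = 0.
Proof.
have /finite_seqP[s sE] : finite_set [set x | submod_val f x != 0] := submod_valP f.
exists (undup s) => [|x]; first exact: undup_uniq.
rewrite mem_undup; apply: contraNeq => fx.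
by have : [set` s] x by rewrite -sE.
Qed.

Lemma free_sum (f : free) (s : seq X) : uniq s -> (forall x, x \notin s -> coef x f = 0) ->
  f = \sum_(y <- s) (coef y f : R) *: delta y.
Proof.
move=> us hs; apply: free_ext => x; rewrite linear_sum /=.
have [xs|xs] := boolP (x \in s).
  rewrite (bigD1_seq x) //= big1 => [|y yx]; last by rewrite coefZ coef_delta (negPf yx) mulr0.
  by rewrite coefZ coef_delta eqxx addr0 mulr1.
rewrite hs // big_seq big1 // => y ys; rewrite coefZ coef_delta.
by case: (y =P x) => [yx|_]; [rewrite -yx ys in xs | rewrite mulr0].
Qed.

(** Only the terms of [f] itself have to lie in [U], so restrictions on the support or on the
    coefficients of [f] can be used. *)
Lemma free_additive_ind (U : set free) (f : free) : U 0 -> (forall g h, U g -> U h -> U (g + h)) ->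
  (forall y, U ((coef y f : R) *: delta y)) -> U f.
Proof.
move=> U0 UD Uf; have [s us fs] := free_support f.
by rewrite (free_sum us fs); apply: big_ind.
Qed.

Lemma free_lift (B : lmodType R) (g : X -> B) :
  exists h : {linear free -> B}, forall x, h (delta x) = g x.
Proof.
pose h (f : free) := \sum_(y \in [set: X]) (coef y f : R) *: g y.
have hE f (s : seq X) : uniq s -> (forall x, x \notin s -> coef x f = 0) ->
    h f = \sum_(y <- s) (coef y f : R) *: g y.
  move=> us fs; rewrite /h (fsbigE s) //.
    by apply: eq_bigl => y; rewrite in_setT.
  by move=> y _ /fs ->; rewrite scale0r.
have [|h' h'E] := linear_of (f := h).
  move=> a f f'; have [s _ fs] := free_support f; have [s' _ fs'] := free_support f'.
  have sub x : x \notin undup (s ++ s') -> x \notin s /\ x \notin s'.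
    by rewrite mem_undup mem_cat negb_or => /andP[].
  rewrite !(hE _ (undup (s ++ s'))) ?undup_uniq //.
  - rewrite scaler_sumr -big_split /=; apply: eq_bigr => y _.
    by rewrite coefD coefZ scalerDl scalerA.
  - by move=> x /sub[_ /fs'].
  - by move=> x /sub[/fs].
  - by move=> x /sub[/fs fx /fs' fx']; rewrite coefD coefZ fx fx' mulr0 addr0.
exists h' => x; rewrite h'E (hE _ [:: x]) //.
  by rewrite big_seq1 coef_delta eqxx scale1r.
by move=> y; rewrite inE eq_sym coef_delta => /negPf ->.
Qed.

Lemma free_linear_ext (B : lmodType R) (g h : {linear free -> B}) :
  (forall x, g (delta x) = h (delta x)) -> g =1 h.
Proof.
move=> gh f; apply: (free_additive_ind (U := [set f | g f = h f])) => /=.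
- by rewrite !linear0.
- by move=> x y gx gy; rewrite !linearD gx gy.
- by move=> y; rewrite !linearZ gh.
Qed.

Lemma free_projective : projective free.
Proof.
move=> N M g f /choice[c cE].
have [h hE] := free_lift (fun x => c (f (delta x))).
exists h => x; apply: (@free_linear_ext _ (g \o h) f) => {}x /=.
by rewrite hE cE.
Qed.

Definition supported (Y : set X) : set free := [set f | forall x, coef x f != 0 -> Y x].

Lemma supported_submodule Y : submodule (supported Y).
Proof.
split=> [x|a f g hf hg x]; first by rewrite coef0 eqxx.
rewrite coefD coefZ; have [fx|/hf //] := eqVneq (coef x f) 0.
by rewrite fx mulr0 add0r => /hg.
Qed.

Lemma supported_delta Y x : Y x -> supported Y (delta x).
Proof. by move=> Yx y; rewrite coef_delta; case: (x =P y) => [<-|] //; rewrite eqxx. Qed.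

Lemma supported_image (B : lmodType R) (h : {linear free -> B}) (Y : set X) (U : set B) :
  submodule U -> (forall y, Y y -> U (h (delta y))) -> forall f, supported Y f -> U (h f).
Proof.
move=> sU hU f Yf; apply: (free_additive_ind (U := h @^-1` U)).
- exact: (preimage_submodule h sU).1.
- by move=> x y; apply: (submoduleD (preimage_submodule h sU)).
- move=> y; rewrite /preimage /= linearZ /=; have [->|/Yf/hU Uy] := eqVneq (coef y f) 0.
    by rewrite scale0r; apply: submodule0.
  exact: submoduleZ.
Qed.

(** For the radical [J] this is [J F], where [F] is the free module. *)
Definition coefs_in (I : set R^o) : set free := [set f | forall x, I (coef x f)].

Lemma coefs_in_submodule I : submodule I -> submodule (coefs_in I).
Proof.
move=> sI; split=> [x|a f g hf hg x]; first by rewrite coef0; apply: submodule0.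
by rewrite coefD coefZ; apply: sI.2.
Qed.

End Basis.

Arguments delta {X} x.

Lemma coefs_in_image (X Z : choiceType) (h : {linear free X -> free Z}) (I J : set R^o) :
  submodule J -> (forall x (a : R), I a -> coefs_in J (a *: h (delta x))) ->
  forall f, coefs_in I f -> coefs_in J (h f).
Proof.
move=> /(coefs_in_submodule Z) sJ hIJ f If.
apply: (free_additive_ind (U := h @^-1` coefs_in J)).
- exact: (preimage_submodule h sJ).1.
- by move=> x y; apply: (submoduleD (preimage_submodule h sJ)).
- by move=> y; rewrite /preimage /= linearZ; apply: hIJ.
Qed.

Lemma coefs_in_jacobson (X Z : choiceType) (h : {linear free X -> free Z}) f :
  coefs_in (@jacobson R) f -> coefs_in (@jacobson R) (h f).
Proof.
apply: coefs_in_image; first exact: jacobson_submodule.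
by move=> x a Ja z; rewrite coefZ; apply: jacobson_mulr.
Qed.

Hypothesis artR : left_artinian R.

(* Neumann series: [h] is nilpotent. *)
Lemma one_sub_left_inverse (X : choiceType) (h : {linear free X -> free X}) :
  (forall f, coefs_in (@jacobson R) (h f)) ->
  exists u : {linear free X -> free X}, forall f, u (f - h f) = f.
Proof.
move=> hJ; have [k k0] := jacobson_nilpotent artR.
have hk n f : coefs_in (jpow n) (iter n h f).
  elim: n => // n; rewrite iterS; apply: coefs_in_image; first exact: jpow_submodule.
  by move=> x a na z; rewrite coefZ; apply: jpow_mul => //; apply: hJ.
(* Replacing [u] by [1 + u h] at each step builds [1 + h + ... + h^(k-1)]. *)
have [u uE] : exists u : {linear free X -> free X}, forall f, u (f - h f) = f - iter k h f.
  elim: k {k0} => [|k [u uE]]; first by exists \0 => f; rewrite subrr.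
  exists (idfun \+ (u \o h)) => f /=; rewrite linearB uE -iterSr.
  by rewrite addrA subrK.
exists u => f; rewrite uE (_ : iter k h f = 0) ?subr0 //.
by apply: free_ext => x; rewrite coef0; apply/k0/hk.
Qed.

(* Modulo the radical [q] factors through [d], since semisimplicity lets one extend
   [d f |-> q f] to the whole of [free X]; nilpotence corrects the factorization. *)
Lemma splits_of_coefs_in_jacobson (X Z : choiceType) (d : {linear free Z -> free X})
    (q : {linear free Z -> free Z}) :
  (forall f, d (q f) = d f) -> (forall f, d f = 0 -> q f = 0) ->
  (forall f, coefs_in (@jacobson R) (d f) -> coefs_in (@jacobson R) (q f)) ->
  exists s : {linear free X -> free Z}, forall f, d (s (d f)) = d f.
Proof.
move=> dq dq0 dJ.
have sJX := coefs_in_submodule X (@jacobson_submodule R).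
have sJZ := coefs_in_submodule Z (@jacobson_submodule R).
set JX := coefs_in _ in sJX; set JZ := coefs_in _ in sJZ.
pose U := [set z | exists x y, [/\ range d x, JX y & z = x + y]].
have sU : submodule U by apply: submodule_sum => //; apply: (image_submodule d (submoduleT _)).
have JXU : JX `<=` U.
  by move=> y Jy; exists 0, y; rewrite add0r; split => //; exists 0; rewrite ?linear0.
have dU f : U (d f).
  by exists (d f), 0; rewrite addr0; split => //; apply: submodule0.
have [//|j f Jj _ x|W [sW JW _ WU WE]] :=
    complement_mod_jacobson artR (submoduleT (free X)) sJX sU JXU.
  by rewrite coefZ; apply: jacobson_mulr.
(* Each basis element is split along [range d], [JX] and [W]; the linear map [C] selects a preimage
   of the first component. *)
have /choice[c cE] x : exists z, exists j w, [/\ JX j, W w & delta x = d z + j + w].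
  have [w [_ [Ww [_ [j [[z _ <-] Jj ->]] ->]]]] := WE (delta x) Logic.I.
  by exists z, j, w; split => //; rewrite addrC.
have [C CE] := free_lift c.
have CW f : exists j w, [/\ JX j, W w & f = d (C f) + j + w].
  apply: (free_additive_ind (U := [set f | exists j w, [/\ JX j, W w & f = d (C f) + j + w]])) => /=.
  - by exists 0, 0; rewrite !linear0 !addr0; split => //; apply: submodule0.
  - move=> g h [j [w [Jj Ww gE]]] [j' [w' [Jj' Ww' hE]]].
    exists (j + j'), (w + w'); split; [exact: (submoduleD sJX)|exact: (submoduleD sW)|].
    by rewrite {1}gE {1}hE !linearD addrACA [X in X + _]addrACA.
  - move=> y; have [j [w [Jj Ww yE]]] := cE y; set a : R := coef y f.
    exists (a *: j), (a *: w); split; [exact: (submoduleZ _ sJX)|exact: (submoduleZ _ sW)|].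
    by rewrite !linearZ /= CE -!scalerDr -yE.
(* [d (f - C (d f)) = j + w], where [w] is in both [W] and [U] and hence in [JX]; the assumption on
   [d] and [q] then applies to [f - C (d f)]. *)
have [r rd] : exists r : {linear free X -> free Z}, forall f, JZ (q f - r (d f)).
  exists (q \o C) => f.
  have [j [w [Jj Ww dfE]]] := CW (d f).
  rewrite /= -linearB; apply: dJ.
  have E : d (f - C (d f)) = j + w.
    by rewrite linearB [X in X - _]dfE -[d _ + j + w]addrA [LHS]addrC addKr.
  rewrite E; apply: (submoduleD sJX) => //; apply: WU; split => //.
  rewrite -[w](addKr j) -E addrC.
  by apply: (submoduleB sU) => //; apply: JXU.
have qq f : q (q f) = q f.
  by apply/eqP; rewrite -subr_eq0 -linearB; apply/eqP/dq0; rewrite linearB dq subrr.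
(* [q - q r d = q (q - r d)] takes values in [JZ], and [1 - q + q r d] sends [q f] to [q r (d f)];
   therefore [u q r d = q]. *)
have [|u uE] := one_sub_left_inverse (h := q \- (q \o (r \o d))).
  by move=> f /=; rewrite -{1}[q f]qq -linearB; apply: coefs_in_jacobson; apply: rd.
exists (u \o (q \o r)) => f /=.
by move: (uE (q f)); rewrite /= dq qq subKr => ->; apply: dq.
Qed.

(** Leading coefficients: order [Y] by an injection into the naturals. The coefficients at [y] of
    the elements of [K] with no later index form a left ideal [A y]; lifting countably many
    generators of each [A y] gives [G]. *)
Lemma supported_countably_generated (X : choiceType) (Y : set X) (K : set (free X)) :
  countable Y -> submodule K -> K `<=` supported Y ->
  exists G, [/\ countable G, G `<=` K & K `<=` span G].
Proof.
move=> cY sK KY; have /countable_injP[phi phi_inj] := cY.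
pose below n : set (free X) := [set f | forall z, coef z f != 0 -> (phi z <= n)%N].
have sbelow n : submodule (below n).
  by apply: (supported_submodule [set z | (phi z <= n)%N]).
pose A y : set R^o := coef y @` (K `&` below (phi y)).
have sA y : submodule (A y) by apply/image_submodule/submoduleI.
have /choice[g gP] y := artinian_countably_generated artR (sA y).
have /choice[l lP] (ya : X * R) : exists f, A ya.1 ya.2 -> [/\ K f, below (phi ya.1) f & coef ya.1 f = ya.2].
  have [[f [Kf bf] fE]|NA] := pselect (A ya.1 ya.2); first by exists f.
  by exists 0.
pose G := \bigcup_(y in Y) ((fun a => l (y, a)) @` g y).
have gA y : g y `<=` A y by case: (gP y).
have GK : G `<=` K by move=> _ [y Yy [a /gA Aa <-]]; have [] := lP (y, a) Aa.
have sG := span_submodule G.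
exists G; split => //.
  by apply: bigcup_countable => // y _; apply: countable_image; case: (gP y).
have H n f : K f -> (forall z, coef z f != 0 -> (phi z < n)%N) -> span G f.
  elim: n f => [|n IHn] f Kf fn.
    have -> : f = 0; last exact: submodule0.
    by apply: free_ext => x; rewrite coef0; apply/eqP; apply: contraT => /fn.
  have [[y [fy yn]]|Ny] := pselect (exists y, coef y f != 0 /\ phi y = n); last first.
    apply: IHn => // z fz; rewrite ltn_neqAle -ltnS fn // andbT.
    by apply/eqP => zn; apply: Ny; exists z.
  have Yy : Y y by apply: KY fy.
  have bf : below n f by move=> z /fn.
  have : A y (coef y f) by exists f => //; split; rewrite ?yn.
  case: (gP y) => _ _ /[apply]; move=> gf.
  (* This finds [u] in [span G] with the leading coefficient of [f]; the indices occurring in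
     [f - u] are then smaller than [n]. *)
  have [|a ga|u [Ku bu Gu] uE] := gf (coef y @` [set u | [/\ K u, below n u & span G u]]).
  - apply: image_submodule; split=> [|b v w [? ? ?] [? ? ?]].
      by split; apply: submodule0.
    by split; [apply: sK.2 | apply: (sbelow n).2 | apply: sG.2].
  - have [Kl bl lE] := lP (y, a) (gA _ _ ga).
    exists (l (y, a)) => //; split; rewrite -?yn //.
    by apply: span_sub; exists y => //; exists a.
  have Kfu : K (f - u) by apply: (submoduleB sK).
  rewrite -[f](subrK u); apply: (submoduleD sG) => //; apply: IHn => //.
  move=> z fuz; have zn : (phi z <= n)%N by apply: (submoduleB (sbelow n) bf bu).
  rewrite ltn_neqAle zn andbT; apply/eqP => zn'.
  suff zy : z = y by move: fuz; rewrite zy linearB /= uE subrr eqxx.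
  by apply: phi_inj; rewrite ?zn' ?yn ?inE //; apply: (KY _ Kfu).
move=> f Kf; have [s _ fs] := free_support f.
apply: (H (\max_(z <- s) phi z).+1) => // z fz; rewrite ltnS.
by apply: leq_bigmax_seq => //; apply: contraNT fz => /fs ->.
Qed.

End FreeModules.

Arguments delta {R X} x.

(** * Countable subcomplexes of free resolutions *)

(** Recursion on [n], shifting the family, avoids transporting [A] along an equality of indices. *)
Lemma countable_family_single (X : nat -> Type) n (A : set (X n)) : countable A ->
  exists S : forall i, set (X i), (forall i, countable (S i)) /\ S n = A.
Proof.
elim: n X A => [|n IHn] X A cA.
  exists (fun i => if i is 0 return set (X i) then A else set0).
  by split => //; case.
have [S [cS SA]] := IHn (fun i => X i.+1) A cA.
exists (fun i => if i is i.+1 return set (X i) then S i else set0).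
by split => //; case.
Qed.

Section CountableClosure.
Variable R : pzRingType.

Definition basis_of_family (X : choiceType) (H : set (free R X)) : set X :=
  \bigcup_(h in H) [set x | coef x h != 0].

Lemma countable_basis_of_family (X : choiceType) (H : set (free R X)) :
  countable H -> countable (basis_of_family H).
Proof.
move=> cH; apply: bigcup_countable => // h _; have [s _ hs] := free_support h.
apply: finite_set_countable; apply: sub_finite_set (finite_seq s) => x /=.
by apply: contraNT => /hs ->.
Qed.

Lemma supported_basis_of_family (X : choiceType) (H : set (free R X)) :
  span H `<=` supported (basis_of_family H).
Proof.
apply: span_min; first exact: supported_submodule.
by move=> h Hh x hx; exists h.
Qed.

Lemma supported_sub (X : choiceType) (Y Z : set X) : Y `<=` Z -> supported (R := R) Y `<=` supported Z.
Proof. by move=> YZ f Yf x /Yf /YZ. Qed.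

(** A vector has finite support, so a single stage of the chain captures it. *)
Lemma supported_bigcup (X : choiceType) (A : nat -> set X) (f : free R X) :
  (forall k, A k `<=` A k.+1) -> supported (\bigcup_k A k) f ->
  exists k, supported (A k) f.
Proof.
move=> Ainc Af; have [s _ fs] := free_support f.
have mono k l : (k <= l)%N -> A k `<=` A l.
  by move=> /subnK <-; elim: (l - k)%N => // m IHm x /IHm /Ainc.
have [k kP] : exists k, forall x, x \in s -> coef x f != 0 -> A k x.
  elim: s {fs} => [|x s [k IHk]]; first by exists 0%N.
  have [fx|/Af[l _ Al]] := eqVneq (coef x f) 0.
    by exists k => y; rewrite inE => /predU1P[->|/IHk //]; rewrite fx eqxx.
  exists (maxn k l) => y; rewrite inE => /predU1P[-> _|ys fy].
    exact: mono (leq_maxr k l) _ Al.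
  exact: mono (leq_maxl k l) _ (IHk y ys fy).
by exists k => x fx; apply: kP => //; apply: contraNT fx => /fs ->.
Qed.

Lemma countable_image_basis (X Z : choiceType) (h : {linear free R X -> free R Z}) (Y : set X) :
  countable Y -> exists2 Y' : set Z, countable Y' &
    forall f, supported Y f -> supported Y' (h f).
Proof.
move=> cY; pose H := (fun x => h (delta x)) @` Y.
exists (basis_of_family H); first exact/countable_basis_of_family/countable_image.
apply: supported_image; first exact: supported_submodule.
by move=> y Yy; apply: supported_basis_of_family; apply: span_sub; exists y.
Qed.

Hypothesis artR : left_artinian R.

(** The part of [K] supported on [Y] is countably generated, since left ideals of [R] are; preimages
    of the generators involve only countably many basis elements. *)
Lemma countable_preimage_basis (X Z : choiceType) (d : {linear free R Z -> free R X})
    (Y : set X) (K : set (free R X)) :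
  submodule K -> countable Y -> K `<=` range d ->
  exists2 Y' : set Z, countable Y' &
    forall f, K f -> supported Y f -> exists2 g, supported Y' g & d g = f.
Proof.
move=> sK cY Kd.
have sK' := submoduleI sK (@supported_submodule R X Y).
have [G [cG GK KG]] := supported_countably_generated artR cY sK' (@subIsetr _ _ _).
have /choice[p pP] f : exists g, K f -> d g = f.
  by have [/Kd[g _ <-]|NK] := pselect (K f); [exists g | exists 0].
pose H := p @` G; exists (basis_of_family H).
  exact/countable_basis_of_family/countable_image.
move=> f Kf Yf; have KYf : (K `&` supported Y) f by [].
have [||g Hg <-] := KG f KYf (d @` span H).
- exact/image_submodule/span_submodule.
- move=> g Gg; exists (p g); last by apply: pP; case: (GK g Gg).
  by apply: span_sub; exists g.
by exists g => //; apply: supported_basis_of_family.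
Qed.

Section Resolution.
Variables (M : lmodType R) (X : nat -> choiceType).
Variables (d : forall i, {linear free R (X i.+1) -> free R (X i)}).
Variables (aug : {linear free R (X 0%N) -> M}).
Hypothesis exact0 : forall f, aug f = 0 <-> exists g, d 0%N g = f.
Hypothesis exactS : forall i f, d i f = 0 <-> exists g, d i.+1 g = f.
Variable s : forall i, {linear free R (X i) -> free R (X i.+1)}.

(** [T] absorbs one round of images under [d] and [s] and of preimages of cycles. A fixed point
    [closed_step Y Y] describes an exact subcomplex stable under [s]. *)
Record closed_step (S T : forall i, set (X i)) : Prop := ClosedStep {
  step_sub : forall i, S i `<=` T i;
  step_d : forall i f, supported (S i.+1) f -> supported (T i) (d i f);
  step_s : forall i f, supported (S i) f -> supported (T i.+1) (s i f);
  step_exact0 : forall f, supported (S 0%N) f -> aug f = 0 ->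
    exists2 g, supported (T 1%N) g & d 0%N g = f;
  step_exactS : forall i f, supported (S i.+1) f -> d i f = 0 ->
    exists2 g, supported (T i.+2) g & d i.+1 g = f }.

Lemma closed_step_exists (S : forall i, set (X i)) : (forall i, countable (S i)) ->
  exists2 T, (forall i, countable (T i)) & closed_step S T.
Proof.
move=> cS.
have hd i := cid2 (countable_image_basis (d i) (cS i.+1)).
have hs i := cid2 (countable_image_basis (s i) (cS i)).
have [|E0 cE0 hE0] := @countable_preimage_basis _ _ (d 0%N) (S 0%N) _
  (preimage_submodule aug (submodule_eq0 M)) (cS 0%N).
  by move=> f /exact0[g <-]; exists g.
have hE i : {E : set (X i.+2) | countable E & forall f, (d i @^-1` [set 0]) f ->
    supported (S i.+1) f -> exists2 g, supported E g & d i.+1 g = f}.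
  apply/cid2/countable_preimage_basis => //.
    exact: (preimage_submodule (d i) (submodule_eq0 _)).
  by move=> f /exactS[g <-]; exists g.
(* [A] receives the images under [d], [B] those under [s], and [E] the preimages of cycles. [B] and
   [E] are empty in degree 0, where neither kind of element lands. *)
pose A i : set (X i) := s2val (hd i).
pose B i : set (X i) := if i is i.+1 return set (X i) then s2val (hs i) else set0.
pose E i : set (X i) :=
  match i return set (X i) with 0 => set0 | 1 => E0 | i.+2 => s2val (hE i) end.
exists (fun i => (S i `|` A i) `|` (B i `|` E i)).
  move=> i; apply: countable_setU; apply: countable_setU => //.
  - exact: (s2valP (hd i)).
  - by case: i => [|i] //=; exact: (s2valP (hs i)).
  - by case: i => [|[|i]] //=; exact: (s2valP (hE i)).
split.
- by move=> i x Sx; left; left.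
- move=> i f /(s2valP' (hd i)); apply: supported_sub => x Ax; left; right; exact: Ax.
- move=> i f /(s2valP' (hs i)); apply: supported_sub => x Bx; right; left; exact: Bx.
- move=> f Sf af; have [g Eg gf] := hE0 f af Sf; exists g => //.
  by apply: supported_sub Eg => x Ex; right; right.
- move=> i f Sf df; have [g Eg gf] := s2valP' (hE i) f df Sf; exists g => //.
  by apply: supported_sub Eg => x Ex; right; right.
Qed.

(** Iterate the step from the support of [f] and take the union; each condition concerns one
    finitely supported vector, so it is met at the stage after the one containing that vector. *)
Lemma countable_closure n (f : free R (X n)) :
  exists Y, [/\ forall i, countable (Y i), supported (Y n) f & closed_step Y Y].
Proof.
have [S0 [cS0 S0E]] := @countable_family_single (fun i => X i) n _
  (countable_basis_of_family (countable1 f)).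
pose fam := {S : forall i, set (X i) | forall i, countable (S i)}.
have step (S : fam) : {T : fam | closed_step (sval S) (sval T)}.
  by apply: cid; have [T cT ST] := closed_step_exists (svalP S); exists (exist _ T cT).
have [F [F0 FS]] := dependent_choice step (exist _ S0 cS0).
pose Y i := \bigcup_k sval (F k) i.
have Finc i k : sval (F k) i `<=` sval (F k.+1) i by apply: step_sub (FS k) i.
have FY i k : supported (R := R) (sval (F k) i) `<=` supported (Y i).
  by apply: supported_sub => x Fx; exists k.
exists Y; split.
- by move=> i; apply: bigcup_countable => // k _; apply: (svalP (F k)).
- apply: (FY n 0%N); rewrite F0 /= S0E.
  by apply: supported_basis_of_family; apply: span_sub.
split; first by move=> i x.
- by move=> i g /(@supported_bigcup _ _ g (Finc i.+1))[k Fg]; apply/FY/(step_d (FS k)).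
- by move=> i g /(@supported_bigcup _ _ g (Finc i))[k Fg]; apply/FY/(step_s (FS k)).
- move=> g /(@supported_bigcup _ _ g (Finc 0%N))[k Fg] ag.
  by have [h Fh hg] := step_exact0 (FS k) Fg ag; exists h => //; apply: FY Fh.
- move=> i g /(@supported_bigcup _ _ g (Finc i.+1))[k Fg] dg.
  by have [h Fh hg] := step_exactS (FS k) Fg dg; exists h => //; apply: FY Fh.
Qed.

End Resolution.
End CountableClosure.

(** * The resolution carried by a closed family of basis subsets *)

Section Subresolution.
Variable R : pzRingType.

Definition free_on (X : choiceType) (Y : set X) : lmodType R :=
  submod (@supported_submodule R X Y).

Definition free_on_val (X : choiceType) (Y : set X) : {linear free_on Y -> free R X} :=
  @submod_val R _ _ (@supported_submodule R X Y).

Arguments free_on_val {X Y}.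

(** Kill the basis elements outside [Y]. The retraction gives projectivity of [free_on Y] and lets
    maps defined on it extend to the whole free module. *)
Lemma free_on_proj (X : choiceType) (Y : set X) :
  exists p : {linear free R X -> free_on Y}, cancel (@free_on_val X Y) p.
Proof.
have [r rE] := @free_lift R X (free R X) (fun x => if `[< Y x >] then delta x else 0).
have [f|p pE] := submod_corestrict (@supported_submodule R X Y) (f := r).
  apply: (@supported_image _ _ _ _ setT) => //; first exact: supported_submodule.
  move=> y _; rewrite rE; case: asboolP => [Yy|_]; first exact: supported_delta.
  exact: submodule0 (@supported_submodule R X Y).
exists p => f; apply: submod_val_inj; rewrite pE.
apply/eqP; rewrite -subr_eq0; apply/eqP.
apply: (@supported_image _ _ _ (r \- idfun) Y [set 0]); last exact: submod_valP f.
  exact: submodule_eq0.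
by move=> y Yy /=; rewrite rE; case: asboolP => // _; rewrite subrr.
Qed.

Lemma free_on_projective (X : choiceType) (Y : set X) : projective (free_on Y).
Proof.
have [p pK] := free_on_proj Y.
exact: (projective_retract pK (@free_projective R X)).
Qed.

Variables (M : lmodType R) (X : nat -> choiceType).
Variables (d : forall i, {linear free R (X i.+1) -> free R (X i)}).
Variables (aug : {linear free R (X 0%N) -> M}).
Hypothesis exact0 : forall f, aug f = 0 <-> exists g, d 0%N g = f.
Hypothesis exactS : forall i f, d i f = 0 <-> exists g, d i.+1 g = f.
Variable s : forall i, {linear free R (X i) -> free R (X i.+1)}.
Variable Y : forall i, set (X i).
Arguments Y : clear implicits.
Hypothesis closedY : closed_step d aug s Y Y.

Let Q i := free_on (Y i).
Let N : lmodType R := submod (image_submodule aug (@supported_submodule R _ (Y 0%N))).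

Lemma subres_diff i : {e : {linear Q i.+1 -> Q i} |
  forall x, free_on_val (e x) = d i (free_on_val x)}.
Proof.
apply: cid; have [|e eE] := submod_corestrict (@supported_submodule R _ (Y i))
  (f := d i \o @free_on_val _ (Y i.+1)).
  by move=> x; apply: (step_d closedY); apply: submod_valP x.
by exists e.
Qed.

Lemma subres_aug : {e : {linear Q 0%N -> N} | forall x, submod_val (e x) = aug (free_on_val x)}.
Proof.
apply: cid; have [|e eE] := submod_corestrict
  (image_submodule aug (@supported_submodule R _ (Y 0%N)))
  (f := aug \o @free_on_val _ (Y 0%N)).
  by move=> x; exists (free_on_val x) => //; apply: submod_valP x.
by exists e.
Qed.

Let e i := sval (subres_diff i).
Let eE i x : free_on_val (e i x) = d i (free_on_val x). Proof. exact: (svalP (subres_diff i)). Qed.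
Let a := sval subres_aug.
Let aE x : submod_val (a x) = aug (free_on_val x). Proof. exact: (svalP subres_aug). Qed.
Let valI i : injective (@free_on_val _ (Y i)). Proof. exact: submod_val_inj. Qed.

Lemma free_on_sub (Z : choiceType) (A : set Z) f : supported A f ->
  exists x : free_on A, free_on_val x = f.
Proof. exact: submod_sub. Qed.

Lemma free_on_supported (Z : choiceType) (A : set Z) (x : free_on A) :
  supported A (free_on_val x).
Proof. exact: submod_valP x. Qed.

Arguments free_on_supported {Z A} x _ _.

Lemma subres_aug_surj y : exists x, a x = y.
Proof.
have [f Yf fy] := submod_valP y; have [x xE] := free_on_sub Yf.
by exists x; apply: submod_val_inj; rewrite aE xE.
Qed.

Lemma subres_exact0 x : a x = 0 <-> exists y, e 0%N y = x.
Proof.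
split=> [ax|[y <-]].
  have af : aug (free_on_val x) = 0 by rewrite -aE ax linear0.
  have [g Yg gE] := step_exact0 closedY (free_on_supported x) af.
  by have [y yE] := free_on_sub Yg; exists y; apply: valI; rewrite eE yE.
by apply: submod_val_inj; rewrite aE eE linear0; apply/exact0; exists (free_on_val y).
Qed.

Lemma subres_exactS i x : e i x = 0 <-> exists y, e i.+1 y = x.
Proof.
split=> [ex|[y <-]].
  have df : d i (free_on_val x) = 0 by rewrite -eE ex linear0.
  have [g Yg gE] := step_exactS closedY (free_on_supported x) df.
  by have [y yE] := free_on_sub Yg; exists y; apply: valI; rewrite eE yE.
by apply: valI; rewrite !eE linear0; apply/exactS; exists (free_on_val y).
Qed.

Definition subres : projective_resolution N :=
  ProjRes (fun i => @free_on_projective _ (Y i)) subres_aug_surj subres_exact0 subres_exactS.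

Lemma subres_splits_at n : (forall f, d n (s n (d n f)) = d n f) -> splits_at subres n.
Proof.
move=> sn; have [p pK] := free_on_proj (Y n.+1).
exists (p \o (s n \o @free_on_val _ (Y n))) => x; apply: valI.
rewrite /= !eE; set g := s n _.
(* Closedness puts [s_n d_n x] in the subcomplex, where the retraction [p] changes nothing. *)
have Yg : supported (Y n.+1) g 
  by apply: (step_s closedY); apply: (step_d closedY); apply: free_on_supported.
have [z zE] := free_on_sub Yg.
by rewrite -zE pK zE /g sn.
Qed.

(** Transfers a splitting of the subcomplex to the ambient free modules, where it can be composed
    with maps not defined on the subcomplex. *)
Lemma subres_splits_at_lift n : splits_at subres n ->
  exists t : {linear free R (X n) -> free R (X n.+1)},
    forall f, supported (Y n.+1) f -> d n (t (d n f)) = d n f.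
Proof.
move=> [t tE]; have [p pK] := free_on_proj (Y n).
exists (@free_on_val _ (Y n.+1) \o (t \o p)) => f /free_on_sub[x <-] /=.
by rewrite -!eE pK -[X in _ = free_on_val X]tE.
Qed.

Lemma subres_countably_generated : countable (Y 0%N) -> countably_generated N.
Proof.
move=> cY; have [p pK] := free_on_proj (Y 0%N).
exists ((fun x => a (p (delta x))) @` Y 0%N); first exact: countable_image.
move=> U [U0 UD] GU y; have [x <-] := subres_aug_surj y.
rewrite -[x]pK; apply: (@supported_image _ _ _ (a \o p) (Y 0%N) [set z | z \in U]).
- by split=> // b z w; apply: UD.
- by move=> z Yz; apply: GU; exists z.
- exact: free_on_supported.
Qed.

End Subresolution.

(** * The standard free resolution *)

Section StandardResolution.
Variables (R : pzRingType).

Definition free_eval (Z : lmodType R) : {linear free R Z -> Z} := sval (cid (free_lift id)).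

Lemma free_eval_delta (Z : lmodType R) (z : Z) : free_eval Z (delta z) = z.
Proof. exact: (svalP (cid (free_lift id))). Qed.

Fixpoint syzygy (M : lmodType R) n : lmodType R :=
  if n is n.+1 then kernel (free_eval (syzygy M n)) else M.

Variable M : lmodType R.

Definition standard_diff i :
    {linear free R (syzygy M i.+1) -> free R (syzygy M i)} :=
  (@submod_val R _ _ _ : {linear syzygy M i.+1 -> free R (syzygy M i)}) \o
    free_eval (syzygy M i.+1).

Lemma standard_exact i f :
  free_eval (syzygy M i) f = 0 <-> exists g, standard_diff i g = f.
Proof.
split=> [ef|[g <-]]; last exact: kernelP.
have [z <-] := submod_sub (preimage_submodule (free_eval (syzygy M i)) (submodule_eq0 _)) ef.
by exists (delta (z : syzygy M i.+1)); rewrite /standard_diff /= free_eval_delta.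
Qed.

Lemma standard_exactS i f :
  standard_diff i f = 0 <-> exists g, standard_diff i.+1 g = f.
Proof.
rewrite -standard_exact; split=> [h|h]; last by rewrite /standard_diff /= h linear0.
by apply: submod_val_inj; rewrite linear0; exact: h.
Qed.

Lemma standard_aug_surj (y : M) : exists x, free_eval M x = y.
Proof. by exists (delta y); apply: free_eval_delta. Qed.

End StandardResolution.

(** * Countably generated modules of prescribed projective dimension *)

Lemma countably_generated_of_free_resolution (R : pzRingType) (artR : left_artinian R)
    (M : lmodType R) (X : nat -> choiceType)
    (d : forall i, {linear free R (X i.+1) -> free R (X i)})
    (aug : {linear free R (X 0%N) -> M}) m :
  (forall y, exists x, aug x = y) ->
  (forall f, aug f = 0 <-> exists g, d 0%N g = f) ->
  (forall i f, d i f = 0 <-> exists g, d i.+1 g = f) ->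
  has_proj_res_of_length M m.+1 ->
  (forall l, has_proj_res_of_length M l -> (m < l)%N) ->
  exists N : lmodType R, [/\ countably_generated N, has_proj_res_of_length N m.+1 &
    forall l, has_proj_res_of_length N l -> (m < l)%N].
Proof.
move=> aug_surj exact0 exactS Mm mmin.
pose C := ProjRes (fun i => @free_projective R (X i)) aug_surj exact0 exactS.
(* The closure asks for a map in every degree; those below degree [m + 1] are set to 0. *)
have sP i : {s : {linear free R (X i) -> free R (X i.+1)} |
    (m.+1 <= i)%N -> forall f, d i (s (d i f)) = d i f}.
  apply: cid; have [mi|_] := leqP m.+1 i; last by exists \0.
  by have [s sE] := has_res_splits_at C (has_res_monotone mi Mm); exists s.
pose s i := sval (sP i).
have sE : forall f, d m.+1 (s m.+1 (d m.+1 f)) = d m.+1 f by apply: (svalP (sP m.+1)).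
have dd f : d m (d m.+1 f) = 0 by apply/exactS; exists f.
pose q : {linear free R (X m.+1) -> free R (X m.+1)} := idfun \- (d m.+1 \o s m.+1).
have dq f : d m (q f) = d m f by rewrite /q /= linearB dd subr0.
have dq0 f : d m f = 0 -> q f = 0.
  by move=> /exactS[g <-]; rewrite /q /= sE subrr.
(* Otherwise the resolution would split at [m], and [M] would have a resolution of length [m]. *)
have [f [Jdf Jqf]] : exists f, coefs_in (@jacobson R) (d m f) /\ ~ coefs_in (@jacobson R) (q f).
  apply: contrapT => H; have [|t tE] := splits_of_coefs_in_jacobson artR dq dq0.
    by move=> f Jf; apply: contrapT => nJ; apply: H; exists f.
  suff /mmin : has_proj_res_of_length M m by rewrite ltnn.
  by apply: (splits_at_has_res (C := C)); exists t.
have [Y [cY Yf clY]] := countable_closure artR exact0 exactS s f.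
pose C' := subres exact0 exactS clY.
exists (submod (image_submodule aug (@supported_submodule R _ (Y 0%N)))); split.
- exact: subres_countably_generated.
- by apply: (splits_at_has_res (C := C')); apply: subres_splits_at.
- move=> l Nl; rewrite ltnNge; apply/negP => lm.
  (* As [f] is supported on [Y], the splitting gives [d_m t d_m f = d_m f]. Since [q] kills the
     kernel of [d_m], this yields [q f = q (t (d_m f))], which has coefficients in the radical. *)
  have /subres_splits_at_lift[t tE] := has_res_splits_at C' (has_res_monotone lm Nl).
  apply: Jqf; have -> : q f = q (t (d m f)).
    by apply/eqP; rewrite -subr_eq0 -linearB; apply/eqP/dq0; rewrite linearB tE // subrr.
  by do 2 apply: coefs_in_jacobson.
Qed.

(** The lengths of resolutions are closed upwards, so only the least one [k] has to be matched. *)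
Lemma countably_generated_same_length (R : pzRingType) (artR : left_artinian R)
    (M : lmodType R) n :
  has_proj_res_of_length M n -> exists N : lmodType R, countably_generated N /\
    forall k, has_proj_res_of_length M k <-> has_proj_res_of_length N k.
Proof.
move=> Mn.
have [k Mk kmin] : exists2 k, has_proj_res_of_length M k &
    forall l, has_proj_res_of_length M l -> (k <= l)%N.
  have [k /asboolP Mk kmin] := @ex_minnP (fun k => `[< has_proj_res_of_length M k >])
    (ex_intro _ n (asboolT Mn)).
  by exists k => // l /asboolT; apply: kmin.
suff [N [cN Nk NkN]] : exists N : lmodType R, [/\ countably_generated N,
    has_proj_res_of_length N k &
    forall l, has_proj_res_of_length N l -> (k <= l)%N].
  exists N; split=> // l; split=> [/kmin|/NkN] kl; exact: has_res_monotone kl _.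
case: k Mk kmin => [|m] Mm mmin; last first.
  exact: (countably_generated_of_free_resolution artR (@standard_aug_surj R M)
    (@standard_exact R M 0%N) (@standard_exactS R M)).
(* For [k = 0] the zero module serves. *)
pose N : lmodType R := submod (submodule_eq0 M).
have N0 (x : N) : x = 0 by apply: submod_val_inj; rewrite linear0; exact: submod_valP x.
exists N; split=> //; last by apply/has_res0/projective_zero.
by exists set0 => // U [U0 _] _ x; rewrite (N0 x).
Qed.

Theorem corollary2p2 (R : pzRingType) (hR : left_artinian R) :
  left_FinDim R =
  supremum 0%E
    [set d | exists M : lmodType R,
       countably_generated M /\ (pdim M < +oo)%E /\ d = pdim M].
Proof.
(* Both suprema range over the same set of values. *)
congr (supremum _ _); apply/seteqP; split=> c [M]; last first.
  by move=> [_ [Mfin ->]]; exists M.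
move=> [Mfin ->].
(* With no finite resolution, the infimum would be over the empty set, hence [+oo]. *)
have [n Mn] : exists n, has_proj_res_of_length M n.
  apply: contrapT => H; move: Mfin; rewrite /pdim.
  suff -> : has_proj_res_of_length M = set0 by rewrite image_set0 /infimum eqxx ltxx.
  by rewrite -subset0 => n Mn; apply: H; exists n.
have [N [cN NM]] := countably_generated_same_length hR Mn.
have MN : pdim M = pdim N.
  by rewrite /pdim; congr (infimum _ (_ @` _)); apply/seteqP; split=> k /NM.
by exists N; rewrite -MN.
Qed.
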